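(* Let $\Lambda$ be a row-finite $k$-graph such that $\mathbb{Z}^k$ acts freely on the talented monoid $T_\Lambda$. Then $\Lambda$ is aperiodic (in the sense of Lewin and Sims).
   Context: **$k$-graphs.** $\mathbb{N}=\{0,1,2,\dots\}$, $k\ge 1$, $e_i$ is the $i$-th standard generator of $\mathbb{N}^k$; $\mathbb{N}^k$ is ordered coordinatewise, with $m\vee n$ the coordinatewise maximum. A $k$-graph is a countable small category $\Lambda$ with object set $\Lambda^0$ (identified with the identity morphisms), range and source maps $r,s:\Lambda\to\Lambda^0$, and a functor $d:\Lambda\to\mathbb{N}^k$ with the unique factorization property: if $d(\lambda)=m+n$ there are unique $\mu_1,\mu_2\in\Lambda$ with $\lambda=\mu_1\mu_2$, $d(\mu_1)=m$, $d(\mu_2)=n$ (the product $\mu_1\mu_2$ is defined iff $s(\mu_1)=r(\mu_2)$). For $v\in\Lambda^0$, $n\in\mathbb{N}^k$: $v\Lambda=r^{-1}(v)$ and $v\Lambda^n=\{\lambda\in v\Lambda: d(\lambda)=n\}$. $\Lambda$ is row-finite if every $v\Lambda^n$ is finite (some $v\Lambda^n$ may be empty, i.e. sources are allowed). **Talented monoid.** $T_\Lambda$ is the commutative monoid generated by symbols $v(n)$ ($v\in\Lambda^0$, $n\in\mathbb{Z}^k$) subject to $v(n)=\sum_{\alpha\in v\Lambda^{e_i}}s(\alpha)(n+e_i)$ for all $v$, $n$ and $i\in\{1,\dots,k\}$ with $v\Lambda^{e_i}\neq\emptyset$. $\mathbb{Z}^k$ acts on $T_\Lambda$ by monoid automorphisms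 determined by ${}^{n}v(m)=v(m+n)$. A nonzero $a\in T_\Lambda$ is periodic if ${}^{n}a=a$ for some $0\ne n\in\mathbb{Z}^k$; $\mathbb{Z}^k$ acts freely on $T_\Lambda$ if there is no (nonzero) periodic element. **Aperiodicity (Lewin–Sims).** For $0\le m\le n\le d(\lambda)$, $\lambda(m,n)$ denotes the unique path $\mu_2$ with $\lambda=\mu_1\mu_2\mu_3$, $d(\mu_1)=m$, $d(\mu_2)=n-m$. For $\lambda,\mu\in\Lambda$, $\mathrm{MCE}(\lambda,\mu)$ is the set of $\tau\in\Lambda$ with $d(\tau)=d(\lambda)\vee d(\mu)$, $\tau(0,d(\lambda))=\lambda$, $\tau(0,d(\mu))=\mu$. $\Lambda$ is aperiodic if for every pair of distinct paths $\alpha,\beta\in\Lambda$ with $s(\alpha)=s(\beta)$ there is $\tau\in s(\alpha)\Lambda$ with $\mathrm{MCE}(\alpha\tau,\beta\tau)=\emptyset$. *)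

(* Defs.v *)
From HB Require Import structures.
From mathcomp Require Import all_boot all_order all_algebra finmap.
From mathcomp Require Import boolp classical_sets cardinality.

Set Implicit Arguments.
Unset Strict Implicit.
Unset Printing Implicit Defensive.

Import GRing.Theory.

Local Open Scope classical_set_scope.
Local Open Scope ring_scope.
Local Open Scope quotient_scope.

(* Degrees in N^k are row vectors 'rV[nat]_k, elements of Z^k are row vectors
   'rV[int]_k; in both cases the i-th generator e_i is delta_mx 0 i. *)
Definition deg_le k (m n : 'rV[nat]_k) : Prop :=
  forall i, (m ord0 i <= n ord0 i)%N.
Definition deg_join k (m n : 'rV[nat]_k) : 'rV[nat]_k := map2_mx maxn m n.
Definition deg_sub k (n m : 'rV[nat]_k) : 'rV[nat]_k := map2_mx subn n m.

(* Composition is a total function, but every axiom (and every use below)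
   concerns [cmp a b] only for composable pairs, i.e. when src a = rng b. *)
Record kgraph (k : nat) := KGraph {
  obj : countType;
  mor : countType;
  rng : mor -> obj;
  src : mor -> obj;
  idm : obj -> mor;
  cmp : mor -> mor -> mor;
  deg : mor -> 'rV[nat]_k;
  rng_idm : forall v, rng (idm v) = v;
  src_idm : forall v, src (idm v) = v;
  rng_cmp : forall a b, src a = rng b -> rng (cmp a b) = rng a;
  src_cmp : forall a b, src a = rng b -> src (cmp a b) = src b;
  cmp1m : forall a, cmp (idm (rng a)) a = a;
  cmpm1 : forall a, cmp a (idm (src a)) = a;
  cmpA : forall a b c, src a = rng b -> src b = rng c ->
    cmp a (cmp b c) = cmp (cmp a b) c;
  deg_idm : forall v, deg (idm v) = 0;
  deg_cmp : forall a b, src a = rng b -> deg (cmp a b) = deg a + deg b;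
  factorization : forall l (m n : 'rV[nat]_k), deg l = m + n ->
    exists! p : mor * mor,
      [/\ src p.1 = rng p.2, l = cmp p.1 p.2, deg p.1 = m & deg p.2 = n]
}.

(* v Lambda and v Lambda^n *)
Definition out k (L : kgraph k) (v : obj L) : set (mor L) :=
  [set a | rng a = v].
Definition outn k (L : kgraph k) (v : obj L) (n : 'rV[nat]_k) : set (mor L) :=
  [set a | rng a = v /\ deg a = n].

Definition row_finite k (L : kgraph k) : Prop :=
  forall (v : obj L) (n : 'rV[nat]_k), finite_set (outn v n).

Section TalentedMonoid.
Variables (k : nat) (L : kgraph k).

(* Formal sums of the symbols v(n): the word [:: (v1, n1); ..; (vp, np)] stands
   for v1(n1) + .. + vp(np). The talented monoid is the quotient of the free
   monoid of words by the congruence generated by commutativity and by the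
   defining relations. *)
Definition word : Type := seq (obj L * 'rV[int]_k).
HB.instance Definition _ := Choice.on word.

(* fset_set enumerates a finite set (it is empty on infinite sets), so this is
   the intended right-hand side when L is row-finite. *)
Definition expansion (v : obj L) (n : 'rV[int]_k) (i : 'I_k) : word :=
  [seq (src a, n + delta_mx 0 i) | a <- fset_set (outn v (delta_mx 0 i))].

Inductive word_cong : word -> word -> Prop :=
| cong_refl a : word_cong a a
| cong_sym a b : word_cong a b -> word_cong b a
| cong_trans a b c : word_cong a b -> word_cong b c -> word_cong a c
| cong_cat a b c d :
    word_cong a b -> word_cong c d -> word_cong (a ++ c) (b ++ d)
| cong_comm a b : word_cong (a ++ b) (b ++ a)
| cong_rel v n i : outn v (delta_mx 0 i) !=set0 ->
    word_cong [:: (v, n)] (expansion v n i).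

Definition word_eqv : rel word := fun a b => `[< word_cong a b >].

Lemma word_eqv_refl : reflexive word_eqv.
Proof. by move=> a; apply/asboolP; apply: cong_refl. Qed.

Lemma word_eqv_sym : symmetric word_eqv.
Proof. by move=> a b; apply/asboolP/asboolP; apply: cong_sym. Qed.

Lemma word_eqv_trans : transitive word_eqv.
Proof.
by move=> b a c /asboolP ab /asboolP bc; apply/asboolP; apply: cong_trans ab bc.
Qed.

Canonical word_equiv :=
  EquivRel word_eqv word_eqv_refl word_eqv_sym word_eqv_trans.

Definition talented : Type := {eq_quot word_equiv}.
HB.instance Definition _ := Choice.on talented.
HB.instance Definition _ : EqQuotient _ word_equiv talented :=
  EqQuotient.on talented.

Lemma pi_talentedP (a b : word) :
  \pi_talented a = \pi_talented b <-> word_cong a b.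
Proof.
split; first by move/eqmodP => /asboolP.
by move=> h; apply/eqmodP/asboolP.
Qed.

Definition tadd (x y : talented) : talented := \pi_talented (repr x ++ repr y).

Lemma taddE (a b : word) :
  tadd (\pi_talented a) (\pi_talented b) = \pi_talented (a ++ b).
Proof.
apply/pi_talentedP; apply: cong_cat; apply/pi_talentedP; exact: reprK.
Qed.

Lemma taddA : associative tadd.
Proof.
move=> x y z; elim/quotW: x => a; elim/quotW: y => b; elim/quotW: z => c.
by rewrite (taddE b c) (taddE a b) (taddE a (b ++ c)) (taddE (a ++ b) c) catA.
Qed.

Lemma taddC : commutative tadd.
Proof.
move=> x y; elim/quotW: x => a; elim/quotW: y => b; rewrite (taddE a b) (taddE b a).
by apply/pi_talentedP; apply: cong_comm.
Qed.

Lemma tadd0 : left_id (\pi_talented [::]) tadd.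
Proof. by move=> x; elim/quotW: x => a; rewrite (taddE [::] a). Qed.

HB.instance Definition _ := GRing.isNmodule.Build talented taddA taddC tadd0.

(* the generator v(n) *)
Definition tgen (v : obj L) (n : 'rV[int]_k) : talented :=
  \pi_talented [:: (v, n)].

Definition shift (n : 'rV[int]_k) (a : word) : word :=
  [seq (p.1, p.2 + n) | p <- a].

Lemma shift_cong n a b : word_cong a b -> word_cong (shift n a) (shift n b).
Proof.
elim=> {a b} [a|a b _|a b c _ ab _|a b c d _ ab _ cd|a b|v m i ne].
- exact: cong_refl.
- exact: cong_sym.
- exact: cong_trans.
- by rewrite /shift !map_cat; apply: cong_cat.
- by rewrite /shift !map_cat; apply: cong_comm.
- have -> : shift n (expansion v m i) = expansion v (m + n) i.
    by rewrite /shift -map_comp; apply: eq_map => x /=; rewrite addrAC.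
  exact: cong_rel.
Qed.

Definition act (n : 'rV[int]_k) (x : talented) : talented :=
  \pi_talented (shift n (repr x)).

Lemma actE n (a : word) : act n (\pi_talented a) = \pi_talented (shift n a).
Proof. by apply/pi_talentedP; apply: shift_cong; apply/pi_talentedP; exact: reprK. Qed.

Lemma talented_cat (a b : word) :
  \pi_talented (a ++ b) = \pi_talented a + \pi_talented b.
Proof. by rewrite -taddE. Qed.

Lemma talented_word (a : word) : \pi_talented a = \sum_(p <- a) tgen p.1 p.2.
Proof.
elim: a => [|[v n] a IH]; first by rewrite big_nil.
by rewrite big_cons -IH -talented_cat.
Qed.

Lemma tgen_rel v n i : outn v (delta_mx 0 i) !=set0 ->
  tgen v n = \sum_(a <- fset_set (outn v (delta_mx 0 i)))
               tgen (src a) (n + delta_mx 0 i).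
Proof.
move=> ne; have /pi_talentedP := cong_rel n ne.
by rewrite /tgen => ->; rewrite talented_word big_map.
Qed.

Lemma talented_univ (M : nmodType) (f : obj L -> 'rV[int]_k -> M) :
  (forall v n i, outn v (delta_mx 0 i) !=set0 ->
     f v n = \sum_(a <- fset_set (outn v (delta_mx 0 i)))
               f (src a) (n + delta_mx 0 i)) ->
  exists! g : talented -> M,
    [/\ g 0 = 0, {morph g : x y / x + y} & forall v n, g (tgen v n) = f v n].
Proof.
move=> hf; pose F (a : word) := \sum_(p <- a) f p.1 p.2.
have F_cong a b : word_cong a b -> F a = F b.
  elim=> {a b} [//|a b _ -> //|a b c _ -> _ -> //|a b c d _ ab _ cd|a b|v n i ne].
  - by rewrite /F !big_cat /= -/(F a) ab -/(F c) cd.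
  - by rewrite /F !big_cat /= addrC.
  - by rewrite /F big_map big_seq1 /= (hf _ _ _ ne).
pose g (x : talented) := F (repr x).
have gE a : g (\pi_talented a) = F a.
  by apply: F_cong; apply/pi_talentedP; exact: reprK.
exists g; split=> [|h [h0 hD hg]].
  split=> [||v n]; first by rewrite (gE [::]) /F big_nil.
    move=> x y; elim/quotW: x => a; elim/quotW: y => b.
    by rewrite -talented_cat !gE /F big_cat.
  by rewrite gE /F big_seq1.
apply: funext => x; elim/quotW: x => a; rewrite gE talented_word (big_morph h hD h0).
by apply: eq_bigr => p _; rewrite hg.
Qed.

Lemma act_tgen n v m : act n (tgen v m) = tgen v (m + n).
Proof. exact: actE. Qed.

Lemma act_additive n : act n 0 = 0 /\ {morph act n : x y / x + y}.
Proof.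
split; first exact: actE.
move=> x y; elim/quotW: x => a; elim/quotW: y => b.
by rewrite -talented_cat (actE n a) (actE n b) (actE n (a ++ b)) -talented_cat
  /shift map_cat.
Qed.

Lemma act0 x : act 0 x = x.
Proof.
elim/quotW: x => a; rewrite actE; congr (\pi_talented _).
by elim: a => //= -[v m] a ->; rewrite addr0.
Qed.

Lemma actD m n x : act (m + n) x = act m (act n x).
Proof.
elim/quotW: x => a; rewrite (actE (m + n) a) (actE n a) (actE m (shift n a)).
congr (\pi_talented _).
by elim: a => //= -[v p] a ->; rewrite -addrA (addrC n).
Qed.

Definition periodic (x : talented) : Prop :=
  x <> 0 /\ exists n : 'rV[int]_k, n <> 0 /\ act n x = x.

Definition acts_freely : Prop := ~ exists x : talented, periodic x.

End TalentedMonoid.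

Definition is_segment k (L : kgraph k) (l : mor L) (m n : 'rV[nat]_k)
    (b : mor L) : Prop :=
  exists a c, [/\ src a = rng b, src b = rng c, l = cmp a (cmp b c),
                  deg a = m & deg b = deg_sub n m].

(* l(m, n); meaningful for m <= n <= deg l, where segmentP shows that it is the
   unique path b with is_segment l m n b. *)
Definition segment k (L : kgraph k) (l : mor L) (m n : 'rV[nat]_k) : mor L :=
  xget l [set b | is_segment l m n b].

Lemma segmentP k (L : kgraph k) (l : mor L) (m n : 'rV[nat]_k) :
  deg_le m n -> deg_le n (deg l) ->
  forall b, is_segment l m n b <-> segment l m n = b.
Proof.
move=> mn nl.
have eq1 : deg l = m + (deg_sub n m + deg_sub (deg l) n).
  apply/rowP=> i; rewrite !mxE; have := mn i; have := nl i.
  by rewrite /GRing.add /= => h1 h2; rewrite addnA subnKC // subnKC.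
have ex : exists b, is_segment l m n b.
  have [[a x] [[/= ax lE da dx] _]] := factorization eq1.
  have [[b c] [[/= bc xE db dc] _]] := factorization dx.
  exists b, a, c; split=> //; last by rewrite lE xE.
  by rewrite ax xE rng_cmp.
have uniq b b' : is_segment l m n b -> is_segment l m n b' -> b = b'.
  have cancel (x y z : 'rV[nat]_k) : x + y = x + z -> y = z.
    by move=> /rowP e; apply/rowP=> i; have := e i; rewrite !mxE => /addnI.
  move=> [a [c [ab bc lE da db]]] [a' [c' [ab' bc' lE' da' db']]].
  have dl : deg l = m + (deg b + deg c).
    by rewrite lE !deg_cmp ?rng_cmp // da.
  have dl' : deg l = m + (deg b' + deg c').
    by rewrite {1}lE' !deg_cmp ?rng_cmp // da'.
  have [dc dc'] : deg c = deg_sub (deg l) n /\ deg c' = deg_sub (deg l) n.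
    split.
    - by rewrite eq1 db in dl; move: dl => /cancel /cancel ->.
    - by rewrite eq1 db' in dl'; move: dl' => /cancel /cancel ->.
  have [p [_ pu]] := factorization eq1.
  have h1 : p = (a, cmp b c).
    by apply: pu; split; rewrite /= ?rng_cmp // deg_cmp // db dc.
  have h2 : p = (a', cmp b' c').
    by apply: pu; split; rewrite /= ?rng_cmp // deg_cmp // db' dc'.
  have e : cmp b c = cmp b' c' by have := h2; rewrite h1 => -[].
  have dbc : deg (cmp b c) = deg_sub n m + deg_sub (deg l) n.
    by rewrite deg_cmp // db dc.
  have [q [_ qu]] := factorization dbc.
  have := qu (b, c) (And4 bc erefl db dc).
  have := qu (b', c') (And4 bc' e db' dc').
  by move=> -> [].
have sP : is_segment l m n (segment l m n).
  by have [b hb] := ex; apply: (@xgetPex _ l [set b | is_segment l m n b]); exists b.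
by move=> b; split=> [/(uniq _ _ sP)|<-].
Qed.

Definition MCE k (L : kgraph k) (l u : mor L) : set (mor L) :=
  [set t | [/\ deg t = deg_join (deg l) (deg u),
               segment t 0 (deg l) = l & segment t 0 (deg u) = u]].

Definition aperiodic k (L : kgraph k) : Prop :=
  forall a b : mor L, a <> b -> src a = src b ->
    exists2 t : mor L, out (src a) t & MCE (cmp a t) (cmp b t) = set0.

(* Main.v *)
Require Import Defs.
From mathcomp Require Import all_boot all_algebra.
From mathcomp Require Import finmap boolp classical_sets cardinality.

(** If [L] is not aperiodic, there are distinct paths [a], [b] with common
    source [v] such that [MCE (a t) (b t)] is nonempty for every [t] in
    [v L]. Taking [t = v] shows that [deg a] and [deg b] differ, as otherwise
    [a = b]. Let [p = deg a \/ deg b], [m = p - deg a] and [n = p - deg b], so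
    that [m <> n].

    - A member of [MCE (a t) (b t)] extends [a t] by a path of degree [m] and
      [b t] by a path of degree [n]. Hence no vertex reachable from [v] is a
      source in a direction in which [m] or [n] is positive, and the defining
      relations can be iterated ([tgen_expand]): in the talented monoid,
      [v(0)] is the sum of the [s(t)(m)] over [t] in [v L^m], and also the sum
      of the [s(t)(n)] over [t] in [v L^n].
    - If [t] has degree [m], cutting a member of [MCE (a t) (b t)] at degree
      [p] gives [a t = b t'] with [t'] in [v L^n] ([mce_transfer]). By unique
      factorization and symmetry, [t |-> t'] is a source-preserving bijection
      from [v L^m] onto [v L^n].

    With [x] the sum of the [s(t)(0)] over [t] in [v L^m], it follows that [x]
    translated by [m] and [x] translated by [n] both equal [v(0)], so [m - n]
    fixes [x]. As [v L^m] is nonempty and no defining relation equates a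
    nonempty word with the empty one, [x] is nonzero, hence periodic. *)

Set Implicit Arguments.
Unset Strict Implicit.
Unset Printing Implicit Defensive.

Import GRing.Theory.

Local Open Scope classical_set_scope.
Local Open Scope ring_scope.
Local Open Scope quotient_scope.

(** * Degrees *)

Section Degrees.
Variable k : nat.
Implicit Types m n p : 'rV[nat]_k.

Lemma degDI m n p : m + n = m + p -> n = p.
Proof. by move=> /rowP e; apply/rowP => i; have := e i; rewrite !mxE => /addnI. Qed.

Lemma deg_joinC m n : deg_join m n = deg_join n m.
Proof. by apply/rowP => i; rewrite !mxE maxnC. Qed.

Lemma deg_joinDr m n p : deg_join (m + p) (n + p) = deg_join m n + p.
Proof. by apply/rowP => i; rewrite !mxE -addn_maxl. Qed.

Lemma deg_join_subK m n : m + deg_sub (deg_join m n) m = deg_join m n.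
Proof. by apply/rowP => i; rewrite !mxE; apply: subnKC; apply: leq_maxl. Qed.

(** A generator in a direction used by [m] can be subtracted from [m]. *)
Lemma deg_split m i : (0 < m ord0 i)%N -> exists n, m = delta_mx 0 i + n.
Proof.
move=> mi; exists (deg_sub m (delta_mx 0 i)); apply/rowP => j; rewrite !mxE /=.
by apply/esym/subnKC; case: eqVneq => [->|].
Qed.

End Degrees.

(** * Inseparable pairs of paths *)

Section Paths.
Variables (k : nat) (L : kgraph k).
Implicit Types (a b c d t : mor L) (v : obj L) (m n : 'rV[nat]_k).

(** The uniqueness half of the factorization property: the degree of the first
    factor determines both factors. *)
Lemma cmp_inj a b c d : src a = rng b -> src c = rng d ->
  cmp a b = cmp c d -> deg a = deg c -> a = c /\ b = d.
Proof.
move=> ab cd e dac; have dt := deg_cmp ab.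
have dbd : deg b = deg d.
  by apply: (@degDI _ (deg a)); rewrite -dt e deg_cmp // dac.
have [q [_ qu]] := factorization dt.
have := qu (a, b) (And4 ab erefl erefl erefl).
by rewrite (qu (c, d) (And4 cd e (esym dac) (esym dbd))) => -[-> ->].
Qed.

Lemma deg0_idm a : deg a = 0 -> a = idm (rng a).
Proof.
move=> da; suff [] : a = idm (rng a) /\ idm (src a) = a by [].
by apply: cmp_inj; rewrite ?rng_idm ?src_idm ?cmp1m ?cmpm1 ?deg_idm.
Qed.

Lemma factor_path t m n : deg t = m + n ->
  exists a b, [/\ src a = rng b, t = cmp a b, deg a = m & deg b = n].
Proof. by move=> /factorization[[a b] [h _]]; exists a, b. Qed.

Lemma segment0_prefix t a : deg_le (deg a) (deg t) -> segment t 0 (deg a) = a ->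
  exists2 c, src a = rng c & t = cmp a c.
Proof.
move=> le_at /(segmentP (fun i => _) le_at)[].
  by move=> i; rewrite mxE.
move=> x [c [xa ac -> /deg0_idm x_id _]]; exists c => //.
move: xa; rewrite x_id src_idm => xa.
by rewrite xa -(rng_cmp ac) cmp1m.
Qed.

Lemma mce_ext a b t : MCE a b t -> exists c d,
  [/\ src a = rng c, src b = rng d, cmp a c = t & cmp b d = t].
Proof.
move=> [dt sa sb].
have [|c ac ta] := segment0_prefix _ sa.
  by move=> i; rewrite dt mxE leq_maxl.
have [|d bd tb] := segment0_prefix _ sb.
  by move=> i; rewrite dt mxE leq_maxr.
by exists c, d.
Qed.

Lemma mceC a b t : MCE a b t -> MCE b a t.
Proof. by case=> dt sa sb; split=> //; rewrite deg_joinC. Qed.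

(** [a] and [b] have the same source and cannot be separated by any common
    continuation: this is the failure of aperiodicity at the pair [(a, b)]. *)
Definition inseparable a b : Prop := src a = src b /\
  forall t, rng t = src a -> MCE (cmp a t) (cmp b t) !=set0.

Lemma inseparable_sym a b : inseparable a b -> inseparable b a.
Proof.
move=> [ab h]; split=> // t; rewrite -ab => /h[x /mceC mx]; by exists x.
Qed.

(** The degree by which [a] falls short of the join of [deg a] and [deg b]. *)
Definition codeg a b := deg_sub (deg_join (deg a) (deg b)) (deg a).

Lemma degD_codeg a b : deg a + codeg a b = deg_join (deg a) (deg b).
Proof. exact: deg_join_subK. Qed.

(** The factors completing [a t] and [b t] to a minimal common extension have
    degrees that do not depend on [t]. *)
Lemma mce_cofactors a b t : inseparable a b -> rng t = src a ->
  exists c d, [/\ src t = rng c, src t = rng d,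
    cmp a (cmp t c) = cmp b (cmp t d), deg c = codeg a b & deg d = codeg b a].
Proof.
move=> [ab h] rt; have [x mx] := h _ rt.
have [at_ bt] : src a = rng t /\ src b = rng t by rewrite -ab.
have [c [d []]] := mce_ext mx; rewrite !src_cmp // => tc td xc xd.
have [dx _ _] := mx; move: dx; rewrite !deg_cmp // deg_joinDr => dx.
exists c, d; split=> //; first by rewrite !cmpA // xc xd.
- apply: (@degDI _ (deg a + deg t)).
  by rewrite [RHS]addrAC degD_codeg -dx -xc !deg_cmp ?src_cmp.
- apply: (@degDI _ (deg b + deg t)).
  by rewrite [RHS]addrAC degD_codeg deg_joinC -dx -xd !deg_cmp ?src_cmp.
Qed.

(** If [deg t] is exactly what [a] lacks, then [deg (a t)] is the join of [deg a]
    and [deg b]; the part of a common extension up to that degree is [a t], and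
    it also begins with [b]. *)
Lemma mce_transfer a b t : inseparable a b -> outn (src a) (codeg a b) t ->
  exists2 u, outn (src a) (codeg b a) u & cmp a t = cmp b u.
Proof.
move=> hab [rt dt]; have [ab _] := hab.
have [c [d [tc td e dc dd]]] := mce_cofactors hab rt.
(* [t d] has degree [codeg a b + codeg b a], and is cut at [codeg b a]. *)
have [u [f [uf tdE du df]]] : exists u f,
    [/\ src u = rng f, cmp t d = cmp u f, deg u = codeg b a & deg f = codeg a b].
  by apply: factor_path; rewrite deg_cmp // dd dt addrC.
have ru : rng u = src a by rewrite -rt -(rng_cmp uf) -tdE rng_cmp.
exists u => //; have bu : src b = rng u by rewrite -ab.
have [] // : cmp a t = cmp b u /\ c = f.
apply: cmp_inj; rewrite ?src_cmp //; first by rewrite -!cmpA // e tdE.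
by rewrite !deg_cmp // dt du !degD_codeg deg_joinC.
Qed.

(** Applied at the identity path: if the degrees agree, so do the degrees of
    [a] and [b], and a common extension forces [a = b]. *)
Lemma inseparable_codeg_neq a b : inseparable a b -> a <> b ->
  codeg a b <> codeg b a.
Proof.
move=> hab neq ecd; have [ab _] := hab; apply: neq.
have [c [d [ac ad e dc dd]]] := mce_cofactors hab (rng_idm (src a)).
rewrite src_idm in ac ad.
move: e; rewrite {1}ac {1}ad !cmp1m => e.
have [] // : a = b /\ c = d.
apply: cmp_inj => //; first by rewrite -ab.
apply: (@degDI _ (codeg a b)).
by rewrite addrC degD_codeg deg_joinC -degD_codeg ecd addrC.
Qed.

Lemma inseparable_no_source a b t i : inseparable a b -> rng t = src a ->
  (0 < codeg a b ord0 i)%N -> outn (src t) (delta_mx 0 i) !=set0.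
Proof.
move=> hab rt hi; have [c [_ [tc _ _ dc _]]] := mce_cofactors hab rt.
have [n cE] := deg_split hi; rewrite cE in dc.
have [x [y [xy cxy dx _]]] := factor_path dc.
by exists x; split=> //; rewrite tc cxy rng_cmp.
Qed.

Lemma outn0 v : outn v 0 = [set idm v] :> set (mor L).
Proof.
apply/seteqP; split=> x /=; last by move=> ->; rewrite /outn /= rng_idm deg_idm.
by move=> [<-] /deg0_idm.
Qed.

End Paths.

(** * Iterated relations and the periodic element *)

Section Talented.
Variables (k : nat) (L : kgraph k).
Hypothesis rfL : row_finite L.

(** [v L^n] as a finite set, hence as a duplicate-free sequence. *)
Local Notation paths v n := (fset_set (@outn k L v n)).

Lemma pathsP v n t : reflect (outn v n t) (t \in paths v n).
Proof. by rewrite in_fset_set //; apply: (iffP idP); rewrite inE. Qed.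

Lemma paths_nilp v n : outn v n !=set0 -> nilp (paths v n) = false.
Proof.
move=> [t /pathsP ht]; have {ht} : t \in enum_fset (paths v n) by [].
by apply: contraTF => /nilP ->.
Qed.

(** The sequence form of [v L^(m+n)] being the composable products of [v L^m]
    and the [s(a) L^n]. *)
Lemma paths_add v m n :
  perm_eq [seq cmp a b | a <- paths v m, b <- paths (src a) n] (paths v (m + n)).
Proof.
apply: uniq_perm; [apply: allpairs_uniq_dep| exact: fset_uniq |].
- exact: fset_uniq.
- by move=> a _; apply: fset_uniq.
- move=> p q /allpairsPdep[a [b [/pathsP[_ ha] /pathsP[hb _] ->]]].
  move=> /allpairsPdep[c [d [/pathsP[_ hc] /pathsP[hd _] ->]]] /=.
  by move=> /cmp_inj[]//; rewrite ?ha ?hc // => -> ->.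
move=> t; apply/allpairsPdep/pathsP.
  move=> [a [b [/pathsP[ra da] /pathsP[rb db] ->]]].
  by split; rewrite ?rng_cmp ?deg_cmp ?da ?db.
move=> [rt /factor_path[a [b [ab tE da db]]]]; exists a, b; split=> //.
  by apply/pathsP; split=> //; rewrite -rt tE rng_cmp.
by apply/pathsP.
Qed.

(** The defining relations iterated along a degree [m], provided that no vertex
    reachable from [v] is a source in a direction used by [m]. *)
Lemma tgen_expand (m : 'rV[nat]_k) (v : obj L) (n : 'rV[int]_k) :
  (forall t i, rng t = v -> (0 < m ord0 i)%N ->
     outn (src t) (delta_mx 0 i) !=set0) ->
  tgen v n = \sum_(t <- paths v m) tgen (src t) (n + map_mx Posz m).
Proof.
move sE : (\sum_i m ord0 i)%N => s.
(* Induction on the total degree of [m], expanding [v] first in a direction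
   used by [m]. *)
elim: s m v n sE => [|s IH] m v n sE hm.
  have -> : m = 0.
    apply/rowP => i; rewrite mxE; apply/eqP.
    by move/eqP: sE; rewrite sum_nat_eq0 => /forallP/(_ i).
  rewrite outn0 fset_set1 big_seq_fset1 src_idm; congr tgen.
  by apply/rowP => i; rewrite !mxE addr0.
have [i mi] : exists i, (0 < m ord0 i)%N.
  apply/existsP/contraT; rewrite negb_exists => /forallP m0.
  by move: sE; rewrite big1 // => i _; apply/eqP; rewrite -leqn0 leqNgt.
have [m' mE] := deg_split mi.
rewrite (tgen_rel n (i := i)); last first.
  by have := hm (idm v) i (rng_idm v) mi; rewrite src_idm.
rewrite mE -(perm_big _ (paths_add v _ _)) big_allpairs_dep.
apply: eq_big_seq => a /pathsP[ra da].
rewrite (IH m'); first last.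
- move=> t j rt mj; have at_ : src a = rng t by [].
  have := hm (cmp a t) j; rewrite rng_cmp // src_cmp //; apply=> //.
  by rewrite mE mxE; apply: leq_trans mj (leq_addl _ _).
- have e1 : (\sum_j (delta_mx 0%R i : 'rV[nat]_k) ord0 j = 1)%N.
    rewrite (bigD1 i) //= mxE !eqxx big1 // => j ji.
    by rewrite mxE (negbTE ji) andbF.
  move: sE; rewrite mE; under eq_bigr do rewrite mxE.
  by rewrite big_split /= e1 add1n => -[].
apply: eq_big_seq => t /pathsP[rt _]; rewrite src_cmp //; congr tgen.
by apply/rowP => j; rewrite !mxE -addrA PoszD; case: (_ && _).
Qed.

(** The empty word is alone in its class: the right-hand side of a defining
    relation is never empty. *)
Lemma word_cong_nil (x y : word L) : word_cong x y -> nilp x = nilp y.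
Proof.
elim=> {x y} //.
- by move=> x y z _ -> _ ->.
- by move=> x y z w _ + _; rewrite !/nilp !size_cat !addn_eq0 => -> ->.
- by move=> x y; rewrite /nilp !size_cat addnC.
by move=> v n i /paths_nilp; rewrite /expansion /nilp size_map => ->.
Qed.

(** The sum of the [s(t)(n)] over [t] in [v L^m]. *)
Definition source_sum v m n : talented L := \sum_(t <- paths v m) tgen (src t) n.

Lemma act_source_sum v m n : act n (source_sum v m 0) = source_sum v m n.
Proof.
have [act_0 act_add] := act_additive L n.
rewrite /source_sum (big_morph _ act_add act_0).
by apply: eq_bigr => t _; rewrite act_tgen add0r.
Qed.

Lemma source_sum_neq0 v m n : outn v m !=set0 -> source_sum v m n <> 0.
Proof.
move=> /paths_nilp ne.
have -> : source_sum v m n =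
    \pi_(talented L) [seq (src t, n) | t <- paths v m].
  by rewrite talented_word big_map.
move=> /(pi_talentedP _ [::]) /word_cong_nil; rewrite /nilp size_map.
by move: ne; rewrite /nilp => ->.
Qed.

(** The correspondence [t |-> u] with [a t = b u] is a source-preserving
    bijection between the paths of degrees [codeg a b] and [codeg b a]. *)
Lemma source_sum_transfer a b n : inseparable a b ->
  source_sum (src a) (codeg a b) n = source_sum (src a) (codeg b a) n.
Proof.
move=> hab; have [ab _] := hab.
(* [f t] is the path [u]; the default value [t] of [xget] is never used. *)
pose f t := xget t [set u | outn (src a) (codeg b a) u /\ cmp a t = cmp b u].
have fP t : outn (src a) (codeg a b) t ->
    outn (src a) (codeg b a) (f t) /\ cmp a t = cmp b (f t).
  move=> /(mce_transfer hab)[u hu e].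
  by apply: (@xgetPex _ t [set u | _ u /\ _ = cmp b u]); exists u.
have inj t t' : rng t = src a -> rng t' = src a -> cmp a t = cmp a t' -> t = t'.
  by move=> rt rt' /cmp_inj[].
have injb t t' : rng t = src a -> rng t' = src a -> cmp b t = cmp b t' -> t = t'.
  by rewrite ab => rt rt' /cmp_inj[].
have pf : perm_eq [seq f t | t <- paths (src a) (codeg a b)]
                  (paths (src a) (codeg b a)).
  apply: uniq_perm; [rewrite map_inj_in_uniq //| exact: fset_uniq |].
    move=> t t' /pathsP ht /pathsP ht' e.
    have [[_ et] [_ et']] := (fP _ ht, fP _ ht').
    by apply: inj; [case: ht | case: ht' | rewrite et et' e].
  move=> u; apply/mapP/pathsP; first by move=> [t /pathsP/fP[hf _] ->].
  move=> hu; have hu' : outn (src b) (codeg b a) u by rewrite -ab.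
  have [t ht e] := mce_transfer (inseparable_sym hab) hu'.
  rewrite -ab in ht; exists t; first exact/pathsP.
  have [[rf _] ef] := fP _ ht.
  by apply: injb => //; [case: hu | rewrite -ef].
rewrite /source_sum -(perm_big _ pf) big_map; apply: eq_big_seq => t.
move=> /pathsP ht; have [[rf _] e] := fP _ ht; have [rt _] := ht.
by have /(congr1 (@src _ _)) := e; rewrite !src_cmp -?ab // => ->.
Qed.

Lemma inseparable_periodic a b : inseparable a b -> a <> b ->
  periodic (source_sum (src a) (codeg a b) 0).
Proof.
move=> hab neq; have hba := inseparable_sym hab; have [ab _] := hab.
set x := source_sum _ _ _.
pose z (m : 'rV[nat]_k) : 'rV[int]_k := map_mx Posz m.
have actm : act (z (codeg a b)) x = tgen (src a) 0.
  rewrite act_source_sum (tgen_expand (m := codeg a b)) ?add0r //.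
  by move=> t i; apply: inseparable_no_source.
have actn : act (z (codeg b a)) x = tgen (src a) 0.
  rewrite /x source_sum_transfer // act_source_sum.
  rewrite (tgen_expand (m := codeg b a)) ?add0r //.
  by move=> t i; rewrite ab; apply: inseparable_no_source.
split.
  apply: source_sum_neq0.
  have [c [_ [hc _ _ dc _]]] := mce_cofactors hab (rng_idm (src a)).
  by exists c; split=> //; rewrite -hc src_idm.
exists (- z (codeg b a) + z (codeg a b)); split.
  move=> /eqP; rewrite addrC subr_eq0 => /eqP /rowP e.
  apply: (inseparable_codeg_neq hab neq).
  by apply/rowP => i; have := e i; rewrite !mxE => -[].
by rewrite actD actm -actn -actD addNr act0.
Qed.

End Talented.

Theorem proposition5p2 (k : nat) (k_gt0 : (0 < k)%N) (L : kgraph k)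
    (rfL : row_finite L) (freeL : acts_freely L) :
  aperiodic L.
Proof.
move=> a b neq ab; apply: contrapT => h; apply: freeL.
exists (source_sum (src a) (codeg a b) 0); apply: inseparable_periodic => //.
split=> // t rt; apply/set0P/eqP => e; apply: h; by exists t.
Qed.
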